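(* Let $n>0$ be an integer. Then \[ \sum_{0\le 3j\le n}\frac{(q^3;q^3)_{n-j-1}(1-q^{2n})\,q^{3j^2}}{(q;q)_{n-3j}\,(q^6;q^6)_{j}} \;=\; \sum_{j=-\infty}^{\infty}(-1)^j q^{6j^2}{2n\brack n-3j}_q . \]
   Context: For a non-negative integer $L$, $(a;q)_L=\prod_{k=0}^{L-1}(1-aq^k)$. For integers $m,n$, the $q$-binomial coefficient is ${m+n\brack n}_q=\frac{(q;q)_{m+n}}{(q;q)_m(q;q)_n}$ if $m,n\ge 0$ and $0$ otherwise. *)

(* Defs.v *)
From mathcomp Require Import all_boot all_order all_algebra.
From mathcomp Require Import boolp classical_sets functions cardinality fsbigop.
From mathcomp Require Import zify.
Set Implicit Arguments.
Unset Strict Implicit.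
Unset Printing Implicit Defensive.
Import Order.TTheory GRing.Theory Num.Theory.
Local Open Scope classical_set_scope.
Local Open Scope ring_scope.

(* (a; q)_L *)
Definition qpoch (F : fieldType) (a q : F) (L : nat) : F :=
  \prod_(0 <= k < L) (1 - a * q ^+ k).

(* The coefficient [N brack k]_q, i.e. [m + k brack k]_q with m = N - k; it is
   zero unless both m and k are nonnegative. *)
Definition qbinom (F : fieldType) (q : F) (N k : int) : F :=
  if (0 <= N - k) && (0 <= k) then
    qpoch q q (absz N) / (qpoch q q (absz (N - k)) * qpoch q q (absz k))
  else 0.

(* The finitely supported sum \sum_(j \in setT) of the library is 0 by
   convention on an infinite support; this lemma shows that the bilateral sums
   [sum_j c_j [2n brack n - 3j]_q] never fall under that convention. *)
Lemma qbinom_bilateral_finite (F : fieldType) (q : F) (c : int -> F) (n : nat) :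
  finite_set [set j : int | c j * qbinom q (2 * n)%:Z (n%:Z - 3 * j) != 0].
Proof.
pose s : seq int := [seq i%:Z - n%:Z | i <- iota 0 (2 * n).+1].
apply: (@sub_finite_set _ _ [set` s]); last exact: finite_seq.
move=> j; rewrite /= /qbinom; case: ifPn => [/andP[h1 h2] _|_]; last first.
  by rewrite mulr0 eqxx.
apply/mapP; exists (absz (j + n%:Z)); last by lia.
by rewrite mem_iota; lia.
Qed.

(* Main.v *)
(** Write [1/(q;q)_k = 0] for [k < 0] and [Q = q^3].  Two summations combine.
    The first, a cubic change of base in the sense of Bailey's lemma, is
<<
  sum_r (Q;Q)_{n-r-1} Q^{r^2} / ((q;q)_{n-3r} (Q;Q)_{r-j} (Q;Q)_{r+j})
    = Q^{j^2} (q;q)_{2n-1} / ((q;q)_{n-3j} (q;q)_{n+3j}),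
>>
    an instance of the q-Pfaff-Saalschuetz sum in base [Q]; it follows by
    descending induction on [j] from the telescoping of
    [A_j S_j - B_j S_{j+1}].  The second is the Bailey-pair identity
<<
  sum_j (-1)^j Q^{j^2} / ((Q;Q)_{r-j} (Q;Q)_{r+j}) = 1 / (Q^2;Q^2)_r,
>>
    proved by telescoping in the recurrence on [r].  Multiplying the first by
    [(-1)^j Q^{j^2}], summing over [j] and exchanging sums gives the theorem.
    Negative powers of [q] occur on the way, so [q = 0] is checked apart. *)

Require Import Defs.
From mathcomp Require Import all_boot all_order all_algebra.
From mathcomp Require Import boolp classical_sets functions cardinality fsbigop.
From mathcomp Require Import zify ring.
Set Implicit Arguments.
Unset Strict Implicit.
Import Order.TTheory GRing.Theory Num.Theory.
Local Open Scope classical_set_scope.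
Local Open Scope ring_scope.

(** * q-Pochhammer symbols and their reciprocals at integer index *)

(* The zero for [k < 0] lets all sums over [j] and [r] be treated as bilateral. *)
Definition qpoch_inv (F : fieldType) (q : F) (k : int) : F :=
  if 0 <= k then (qpoch q q `|k|%N)^-1 else 0.

Lemma qpochS (F : fieldType) (a q : F) (L : nat) :
  qpoch a q L.+1 = qpoch a q L * (1 - a * q ^+ L).
Proof. by rewrite /qpoch big_nat_recr. Qed.

Lemma qpoch0 (F : fieldType) (a q : F) : qpoch a q 0 = 1.
Proof. by rewrite /qpoch big_nil. Qed.

Lemma qpoch_neq0 (F : fieldType) (q : F)
    (hq : forall k : nat, (0 < k)%N -> q ^+ k != 1) (L : nat) :
  qpoch q q L != 0.
Proof.
elim: L => [|L IH]; first by rewrite qpoch0 oner_eq0.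
by rewrite qpochS mulf_neq0 // -exprS subr_eq0 eq_sym hq.
Qed.

Lemma expr_neq1 (F : fieldType) (q : F)
    (hq : forall k : nat, (0 < k)%N -> q ^+ k != 1) (m : nat) :
  (0 < m)%N -> forall k : nat, (0 < k)%N -> (q ^+ m) ^+ k != 1.
Proof. by move=> m0 k k0; rewrite -exprM hq // muln_gt0 m0. Qed.

Lemma qpoch_inv_nat (F : fieldType) (q : F) (m : nat) :
  qpoch_inv q m%:Z = (qpoch q q m)^-1.
Proof. by []. Qed.

Lemma qpoch_inv_neg (F : fieldType) (q : F) (k : int) :
  k < 0 -> qpoch_inv q k = 0.
Proof. by rewrite /qpoch_inv ltNge => /negbTE ->. Qed.

(** At [k = 0] the factor [1 - q ^ 0] vanishes together with the left side, so one step of the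
    recurrence is valid at every integer and later computations have no boundary cases. *)
Lemma qpoch_inv_pred (F : fieldType) (q : F)
    (hq : forall k : nat, (0 < k)%N -> q ^+ k != 1) (k : int) :
  qpoch_inv q (k - 1) = (1 - q ^ k) * qpoch_inv q k.
Proof.
case: k => [[|m]|m].
- by rewrite qpoch_inv_neg // expr0z subrr mul0r.
- have -> : m.+1%:Z - 1 = m%:Z by lia.
  rewrite !qpoch_inv_nat qpochS -exprS -exprnP invfM mulrCA mulfV ?mulr1 //.
  by rewrite subr_eq0 eq_sym hq.
- by rewrite !qpoch_inv_neg ?mulr0 //; lia.
Qed.

Lemma expfzB (F : fieldType) (q : F) (a b : int) : q != 0 ->
  q ^ (a - b) = q ^ a / q ^ b.
Proof. by move=> q0; rewrite expfzDr // invr_expz. Qed.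

(** * The Bailey-pair summation *)

Definition bailey_term (F : fieldType) (q : F) (r : nat) (j : int) : F :=
  (-1) ^ j * q ^ (j ^+ 2) * qpoch_inv q (r%:Z - j) * qpoch_inv q (r%:Z + j).

(** With [u = q^(r+1-j)], [v = q^(r+1+j)] and the common factor removed, this is [(1 - u v) - (1 -
    u)(1 - v) = u (1 - v) + v (1 - u)]. *)
Lemma bailey_pair_sum_rec (F : fieldType) (q : F)
    (hq : forall k : nat, (0 < k)%N -> q ^+ k != 1) (q0 : q != 0)
    (r : nat) (j : int) (cert := fun j : int => (-1) ^ j * q ^ (j ^+ 2 - j + r%:Z + 1)
       * qpoch_inv q (r%:Z + 1 - j) * qpoch_inv q (r%:Z + j)) :
  (1 - q ^+ (2 * r.+1)) * bailey_term q r.+1 j - bailey_term q r j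
  = cert j - cert (j + 1).
Proof.
rewrite /bailey_term /cert.
have -> : r.+1%:Z - j = r%:Z + 1 - j by lia.
have -> : r.+1%:Z + j = r%:Z + (j + 1) by lia.
have -> : r%:Z + 1 - (j + 1) = r%:Z + 1 - j - 1 by lia.
have -> : r%:Z - j = r%:Z + 1 - j - 1 by lia.
have -> : r%:Z + j = r%:Z + (j + 1) - 1 by lia.
rewrite !qpoch_inv_pred //.
have -> : (j + 1) ^+ 2 - (j + 1) + r%:Z + 1 = j ^+ 2 + (j + r%:Z + 1) by lia.
have -> : j ^+ 2 - j + r%:Z + 1 = j ^+ 2 + (r%:Z + 1 - j) by lia.
have -> : r%:Z + (j + 1) = r%:Z + 1 + j by lia.
have -> : j + r%:Z + 1 = r%:Z + 1 + j by lia.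
have -> : q ^+ (2 * r.+1) = q ^ (r%:Z + 1 - j) * q ^ (r%:Z + 1 + j).
  by rewrite -expfzDr // exprnP; congr (q ^ _); lia.
have -> : (-1) ^ (j + 1) = - (-1) ^ j :> F.
  by rewrite expfzDr ?oppr_eq0 ?oner_eq0 // expr1z mulrN1.
rewrite !(expfzDr (j ^+ 2)) //.
ring.
Qed.

Lemma bailey_pair_sum (F : fieldType) (q : F)
    (hq : forall k : nat, (0 < k)%N -> q ^+ k != 1) (q0 : q != 0)
    (M r : nat) : (r <= M)%N ->
  \sum_(0 <= i < (2 * M).+1) bailey_term q r (i%:Z - M%:Z)
  = (qpoch (q ^+ 2) (q ^+ 2) r)^-1.
Proof.
elim: r => [|r IH] rM.
  (* For [r = 0] only the index [i = M], that is [j = 0], contributes. *)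
  rewrite /bailey_term (@big_cat_nat _ _ _ M) //=; last by lia.
  rewrite [X in _ + X]big_ltn; last by lia.
  rewrite big_nat_cond big1 ?add0r; last first.
    move=> i /andP[/andP[_ iM] _].
    by rewrite [X in _ * X]qpoch_inv_neg ?mulr0 //; lia.
  rewrite big_nat_cond big1 ?addr0; last first.
    move=> i /andP[/andP[iM _] _].
    by rewrite [X in _ * X * _]qpoch_inv_neg ?mulr0 ?mul0r //; lia.
  by rewrite subrr oppr0 !(qpoch_inv_nat q 0) !qpoch0 !expr0z !invr1 !mulr1.
have c0 : 1 - q ^+ (2 * r.+1) != 0 by rewrite subr_eq0 eq_sym hq.
rewrite qpochS -exprS -exprM invfM -IH; last by lia.
apply: (mulfI c0); rewrite mulrCA mulfV // mulr1.
apply/eqP; rewrite -subr_eq0 !big_distrr /= -sumrB; apply/eqP.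
pose cert (j : int) := (-1) ^ j * q ^ (j ^+ 2 - j + r%:Z + 1)
       * qpoch_inv q (r%:Z + 1 - j) * qpoch_inv q (r%:Z + j).
transitivity (- \sum_(0 <= i < (2 * M).+1)
   (cert (i.+1%:Z - M%:Z) - cert (i%:Z - M%:Z))).
  rewrite -sumrN; apply: eq_bigr => i _; rewrite opprB.
  rewrite bailey_pair_sum_rec // /cert.
  by have -> : i.+1%:Z - M%:Z = i%:Z - M%:Z + 1 by lia.
rewrite telescope_sumr // /cert.
(* Both ends of the window, [j = M + 1] and [j = - M], give the index [r - M], negative because
   [r < M]. *)
rewrite [qpoch_inv q (_ - (_.+1%:Z - _))]qpoch_inv_neg; last by lia.
rewrite [qpoch_inv q (_ + (0%:Z - _))]qpoch_inv_neg; last by lia.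
by rewrite !mulr0 mul0r subrr oppr0.
Qed.

(** * Telescoping for the cubic change of base *)

(** The part of the summand independent of [j]. At [r = n > 0] the truncated [n - r - 1] is
    harmless, since the last factor is then zero. *)
Definition cubic_weight (F : fieldType) (q : F) (n r : nat) : F :=
  qpoch (q ^+ 3) (q ^+ 3) (n - r - 1) * (q ^+ 3) ^+ (r ^ 2)
    * qpoch_inv q (n%:Z - 3 * r%:Z).

(* Ratio [(q;q)_{n+3j+3} / (q;q)_{n+3j}]. *)
Definition cubic_up (F : fieldType) (q : F) (n : nat) (j : int) : F :=
  (1 - q ^ (n%:Z + 3 * j + 1)) * (1 - q ^ (n%:Z + 3 * j + 2))
    * (1 - q ^ (n%:Z + 3 * j + 3)).

(* Ratio [(q;q)_{n-3j} / (q;q)_{n-3j-3}]. *)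
Definition cubic_down (F : fieldType) (q : F) (n : nat) (j : int) : F :=
  (1 - q ^ (n%:Z - 3 * j)) * (1 - q ^ (n%:Z - 3 * j - 1))
    * (1 - q ^ (n%:Z - 3 * j - 2)).

Lemma qpoch_inv_up (F : fieldType) (q : F)
    (hq : forall k : nat, (0 < k)%N -> q ^+ k != 1) (n : nat) (j : int) :
  qpoch_inv q (n%:Z + 3 * j) = cubic_up q n j * qpoch_inv q (n%:Z + 3 * (j + 1)).
Proof.
rewrite /cubic_up.
have -> : n%:Z + 3 * j = n%:Z + 3 * (j + 1) - 1 - 1 - 1 by lia.
rewrite !qpoch_inv_pred //.
have -> : n%:Z + 3 * (j + 1) - 1 - 1 - 1 + 1 = n%:Z + 3 * (j + 1) - 1 - 1 by lia.
have -> : n%:Z + 3 * (j + 1) - 1 - 1 - 1 + 2 = n%:Z + 3 * (j + 1) - 1 by lia.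
have -> : n%:Z + 3 * (j + 1) - 1 - 1 - 1 + 3 = n%:Z + 3 * (j + 1) by lia.
by rewrite !mulrA.
Qed.

Lemma qpoch_inv_down (F : fieldType) (q : F)
    (hq : forall k : nat, (0 < k)%N -> q ^+ k != 1) (n : nat) (j : int) :
  qpoch_inv q (n%:Z - 3 * (j + 1)) = cubic_down q n j * qpoch_inv q (n%:Z - 3 * j).
Proof.
rewrite /cubic_down.
have -> : n%:Z - 3 * (j + 1) = n%:Z - 3 * j - 1 - 1 - 1 by lia.
rewrite !qpoch_inv_pred //.
have -> : n%:Z - 3 * j - 1 - 1 = n%:Z - 3 * j - 2 by lia.
ring.
Qed.

(* The telescoping relation after removing the common q-Pochhammer factors, with
   [x = Q^r], [y = Q^j], [z = q^n]. *)
Lemma cubic_certificate (F : fieldType) (q x y z : F) :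
    q != 0 -> x != 0 -> y != 0 ->
  q ^+ 3 * y ^+ 2 * ((1 - z / y) * (1 - z / y / q) * (1 - z / y / q ^+ 2))
      * (1 - x * y * q ^+ 3)
    - (1 - z * y * q) * (1 - z * y * q ^+ 2) * (1 - z * y * q ^+ 3) * (1 - x / y)
  = (1 - q ^+ 3 * y ^+ 2)
    * (q ^+ 3 * x ^+ 2 * ((1 - z / x) * (1 - z / x / q) * (1 - z / x / q ^+ 2))
       - (1 - x / y) * (1 - x * y * q ^+ 3) * (1 - z ^+ 3 / x)).
Proof. by move=> q0 x0 y0; field; rewrite q0 x0 y0. Qed.

Lemma cubic_downE (F : fieldType) (q : F) (n : nat) (j : int) : q != 0 ->
  cubic_down q n j = (1 - q ^+ n / q ^ (3 * j)) * (1 - q ^+ n / q ^ (3 * j) / q)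
    * (1 - q ^+ n / q ^ (3 * j) / q ^+ 2).
Proof. by move=> q0; rewrite /cubic_down !expfzB. Qed.

Lemma cubic_upE (F : fieldType) (q : F) (n : nat) (j : int) : q != 0 ->
  cubic_up q n j = (1 - q ^+ n * q ^ (3 * j) * q)
    * (1 - q ^+ n * q ^ (3 * j) * q ^+ 2) * (1 - q ^+ n * q ^ (3 * j) * q ^+ 3).
Proof. by move=> q0; rewrite /cubic_up !expfzDr. Qed.

(** The two coefficients are those for which the closed form of the sum satisfies
    [A_j S_j = B_j S_{j+1}]; dividing by the common factor leaves [cubic_certificate]. *)
Lemma cubic_telescoping (F : fieldType) (q : F)
    (hq : forall k : nat, (0 < k)%N -> q ^+ k != 1) (q0 : q != 0)
    (n : nat) (hn : (0 < n)%N) (r : nat) (j : int)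
    (Q := q ^+ 3)
    (cert := fun r : nat => (1 - Q * (q ^ (3 * j)) ^+ 2)
       * (qpoch Q Q (n - r) * Q ^+ (r ^ 2) * qpoch_inv q (n%:Z - 3 * r%:Z)
          * qpoch_inv Q (r%:Z - 1 - j) * qpoch_inv Q (r%:Z + j))) :
  Q * (q ^ (3 * j)) ^+ 2 * cubic_down q n j
      * (cubic_weight q n r * qpoch_inv Q (r%:Z - j) * qpoch_inv Q (r%:Z + j))
    - cubic_up q n j
      * (cubic_weight q n r
           * qpoch_inv Q (r%:Z - (j + 1)) * qpoch_inv Q (r%:Z + (j + 1)))
  = cert r.+1 - cert r.
Proof.
have hQ := expr_neq1 hq (isT : 0 < 3)%N.
rewrite /cert /cubic_weight -/Q.
have -> : r.+1%:Z - 1 - j = r%:Z - j by lia.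
have -> : n%:Z - 3 * r.+1%:Z = n%:Z - 3 * (r%:Z + 1) by lia.
(* Applied at [r] instead of [j], this brings [cert r.+1] to the common factor. *)
rewrite qpoch_inv_down //.
(* For [r >= n] everything vanishes; below [n], the subtraction [n - r - 1] is exact. *)
have [nr|rn] := leqP n r.
  by rewrite [qpoch_inv q _]qpoch_inv_neg ?(mulr0, mul0r, subrr) //; lia.
have -> : r.+1%:Z + j = r%:Z + (j + 1) by lia.
have -> : r%:Z - (j + 1) = r%:Z - j - 1 by lia.
have -> : r%:Z - 1 - j = r%:Z - j - 1 by lia.
have -> : r%:Z + j = r%:Z + (j + 1) - 1 by lia.
rewrite !qpoch_inv_pred //.
have -> : (n - r.+1 = n - r - 1)%N by lia.
have -> : (n - r = (n - r - 1).+1)%N by lia.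
rewrite qpochS -exprS.
have -> : ((n - r - 1).+1 = n - r)%N by lia.
rewrite subn1 /=.
set x := q ^ (3 * r%:Z); set y := q ^ (3 * j).
have x0 : x != 0 by rewrite expfz_neq0.
have y0 : y != 0 by rewrite expfz_neq0.
have -> : Q ^ (r%:Z - j) = x / y.
  by rewrite /Q exprnP exprz_exp mulrBr expfzB.
have -> : Q ^ (r%:Z + (j + 1)) = x * y * Q.
  by rewrite /Q exprnP exprz_exp !mulrDr !expfzDr // mulr1 mulrA.
have -> : Q ^+ (n - r) = (q ^+ n) ^+ 3 / x.
  rewrite /Q -!exprM /x.
  have -> : (n * 3 = 3 * (n - r) + 3 * r)%N by lia.
  by rewrite exprD -[q ^ (3 * r%:Z)]/(q ^+ (3 * r)) mulfK // expf_neq0.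
have -> : Q ^+ (r.+1 ^ 2) = Q ^+ (r ^ 2) * (Q * x ^+ 2).
  rewrite /Q /x -[q ^ (3 * r%:Z)]/(q ^+ (3 * r)) -!exprM -!exprD.
  by congr (q ^+ _); lia.
have E := @cubic_certificate F q x y (q ^+ n) q0 x0 y0.
rewrite (cubic_downE _ _ q0) (cubic_downE _ _ q0) cubic_upE // -/y -/x.
rewrite -/Q in E |- *.
set P := qpoch _ _ _; set p := Q ^+ _; set a := qpoch_inv _ _.
set b := qpoch_inv _ _; set c := qpoch_inv _ _.
transitivity (P * p * a * b * c * (Q * y ^+ 2
  * ((1 - q ^+ n / y) * (1 - q ^+ n / y / q) * (1 - q ^+ n / y / q ^+ 2))
      * (1 - x * y * Q) - (1 - q ^+ n * y * q) * (1 - q ^+ n * y * q ^+ 2)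
      * (1 - q ^+ n * y * Q) * (1 - x / y))).
  (* Quotients become variables: only regrouping remains, and the division is confined to
     [cubic_certificate]. *)
  move: (q ^+ n / y) (x / y) (q ^+ 2) q^-1 => *; ring.
rewrite E.
move: (q ^+ n / y) (x / y) ((q ^+ n) ^+ 3 / x) (q ^+ n / x) (q ^+ 2) => *; ring.
Qed.

(** * Evaluation of the cubic sum *)

Lemma cubic_down_neq0 (F : fieldType) (q : F)
    (hq : forall k : nat, (0 < k)%N -> q ^+ k != 1) (n j : nat) :
  (3 * j.+1 <= n)%N -> cubic_down q n j%:Z != 0.
Proof.
move=> jn; rewrite /cubic_down.
have -> : n%:Z - 3 * j%:Z = (n - 3 * j)%N%:Z by lia.
have -> : (n - 3 * j)%N%:Z - 1 = (n - 3 * j - 1)%N%:Z by lia.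
have -> : (n - 3 * j)%N%:Z - 2 = (n - 3 * j - 2)%N%:Z by lia.
by rewrite !mulf_neq0 // subr_eq0 eq_sym hq //; lia.
Qed.

Lemma cubic_sum_rec (F : fieldType) (q : F)
    (hq : forall k : nat, (0 < k)%N -> q ^+ k != 1) (q0 : q != 0)
    (n : nat) (hn : (0 < n)%N) (j : nat) (Q := q ^+ 3)
    (S := fun j : int => \sum_(0 <= r < n.+1)
       (cubic_weight q n r * qpoch_inv Q (r%:Z - j) * qpoch_inv Q (r%:Z + j))) :
  Q * (q ^ (3 * j%:Z)) ^+ 2 * cubic_down q n j%:Z * S j%:Z
    = cubic_up q n j%:Z * S (j%:Z + 1).
Proof.
apply/eqP; rewrite -subr_eq0 !big_distrr -sumrB; apply/eqP.
under eq_bigr => r _ do rewrite /= cubic_telescoping //.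
rewrite telescope_sumr //.
(* The ends [r = n + 1] and [r = 0] vanish through the indices [n - 3(n+1)] and [-1 - j]. *)
rewrite [qpoch_inv q _]qpoch_inv_neg; last by lia.
rewrite [qpoch_inv _ (0%:Z - 1 - _)]qpoch_inv_neg; last by lia.
by rewrite !(mulr0, mul0r) subrr.
Qed.

(* For [j = n %/ 3] only the term [r = j] of the cubic sum is nonzero. *)
Lemma cubic_sum_edge (F : fieldType) (q : F)
    (hq : forall k : nat, (0 < k)%N -> q ^+ k != 1)
    (n : nat) (hn : (0 < n)%N) (j : nat) (Q := q ^+ 3) :
  (3 * j <= n < 3 * j.+1)%N ->
  cubic_weight q n j * qpoch_inv Q (j%:Z - j%:Z) * qpoch_inv Q (j%:Z + j%:Z)
  = Q ^+ (j ^ 2) * qpoch q q (2 * n).-1 * qpoch_inv q (n%:Z - 3 * j%:Z)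
      * qpoch_inv q (n%:Z + 3 * j%:Z).
Proof.
move=> /andP[jn nj]; have hQ := expr_neq1 hq (isT : 0 < 3)%N.
rewrite subrr (qpoch_inv_nat _ 0) qpoch0 invr1 mulr1 /cubic_weight -/Q.
have -> : n%:Z + 3 * j%:Z = (n + 3 * j)%N%:Z by lia.
have -> : j%:Z + j%:Z = (2 * j)%N%:Z by lia.
rewrite !qpoch_inv_nat.
suff E : qpoch Q Q (n - j - 1) / qpoch Q Q (2 * j)
         = qpoch q q (2 * n).-1 / qpoch q q (n + 3 * j).
  transitivity (Q ^+ (j ^ 2) * qpoch_inv q (n%:Z - 3 * j%:Z)
    * (qpoch Q Q (n - j - 1) / qpoch Q Q (2 * j))); first by ring.
  by rewrite E; ring.
apply/eqP; rewrite eqr_div ?qpoch_neq0 //; apply/eqP.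
(* For the residues 0, 1, 2 of [n] modulo 3, both ratios equal [1 / (1 - q^(6j))], [1] and
   [1 - q^(6j+3)] respectively. *)
have /or3P[] : [|| n == 3 * j, n == (3 * j).+1 | n == (3 * j).+2]%N by lia.
- move=> /eqP nE.
  have -> : (2 * j = (n - j - 1).+1)%N by lia.
  have -> : (n + 3 * j = (2 * n).-1.+1)%N by lia.
  rewrite !qpochS -!exprS.
  have -> : Q ^+ (n - j - 1).+1 = q ^+ (2 * n).-1.+1.
    by rewrite -exprM; congr (q ^+ _); lia.
  by ring.
- move=> /eqP nE.
  have -> : (n - j - 1 = 2 * j)%N by lia.
  have -> : ((2 * n).-1 = n + 3 * j)%N by lia.
  by ring.
- move=> /eqP nE.
  have -> : (n - j - 1 = (2 * j).+1)%N by lia.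
  have -> : ((2 * n).-1 = (n + 3 * j).+1)%N by lia.
  rewrite !qpochS -!exprS.
  have -> : Q ^+ (2 * j).+1 = q ^+ (n + 3 * j).+1.
    by rewrite -exprM; congr (q ^+ _); lia.
  by ring.
Qed.

(** The recurrence determines [S_j] from [S_{j+1}] only while [cubic_down] is nonzero, that is for
    [3(j+1) <= n]; the last [j] with [3j <= n] is evaluated directly, and beyond it both sides
    vanish. *)
Lemma cubic_sum_nat (F : fieldType) (q : F)
    (hq : forall k : nat, (0 < k)%N -> q ^+ k != 1) (q0 : q != 0)
    (n : nat) (hn : (0 < n)%N) (j : nat) (Q := q ^+ 3) :
  \sum_(0 <= r < n.+1)
     (cubic_weight q n r * qpoch_inv Q (r%:Z - j%:Z) * qpoch_inv Q (r%:Z + j%:Z))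
  = Q ^+ (j ^ 2) * qpoch q q (2 * n).-1 * qpoch_inv q (n%:Z - 3 * j%:Z)
      * qpoch_inv q (n%:Z + 3 * j%:Z).
Proof.
(* Descending induction on [j], run as induction on a bound [k] for its distance to the vanishing
   range. *)
have [k] : exists k : nat, (n < 3 * (j + k))%N by exists n.+1; lia.
elim: k j => [|k IH] j nk.
  rewrite [qpoch_inv q (_ - _)]qpoch_inv_neg ?(mulr0, mul0r); last by lia.
  apply: big1_seq => r _; rewrite /cubic_weight.
  have [rj|jr] := ltnP r j.
    by rewrite [qpoch_inv _ (_ - j%:Z)]qpoch_inv_neg ?(mulr0, mul0r) //; lia.
  by rewrite [qpoch_inv q _]qpoch_inv_neg ?(mulr0, mul0r) //; lia.
have [jn|nj] := leqP (3 * j.+1) n; last first.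
  have [jn|jn] := leqP (3 * j) n; last by apply: (IH j); lia.
  rewrite (bigD1_seq j) ?mem_index_iota ?iota_uniq //=; last by lia.
  rewrite big1 ?addr0; first by apply: cubic_sum_edge => //; rewrite jn.
  move=> r rj; rewrite /cubic_weight.
  have [rj'|jr] := ltnP r j.
    by rewrite [qpoch_inv _ (_ - j%:Z)]qpoch_inv_neg ?(mulr0, mul0r) //; lia.
  by rewrite [qpoch_inv q _]qpoch_inv_neg ?(mulr0, mul0r) //; lia.
have c0 : Q * (q ^ (3 * j%:Z)) ^+ 2 * cubic_down q n j%:Z != 0.
  apply: mulf_neq0; last exact: cubic_down_neq0.
  by apply: mulf_neq0; rewrite expf_neq0 ?expfz_neq0.
apply: (mulfI c0); rewrite cubic_sum_rec //.
have := IH j.+1; have -> : j.+1%:Z = j%:Z + 1 by lia.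
move=> ->; last by lia.
rewrite qpoch_inv_down // [qpoch_inv q (n%:Z + 3 * j%:Z)]qpoch_inv_up //.
have -> : Q ^+ (j.+1 ^ 2) = Q ^+ (j ^ 2) * (Q * (q ^ (3 * j%:Z)) ^+ 2).
  rewrite /Q -[q ^ (3 * j%:Z)]/(q ^+ (3 * j)) -!exprM -!exprD.
  by congr (q ^+ _); lia.
by ring.
Qed.

(** Negative [j] follows from the symmetry [j -> -j], which swaps the two reciprocals on each
    side. *)
Lemma cubic_sum (F : fieldType) (q : F)
    (hq : forall k : nat, (0 < k)%N -> q ^+ k != 1) (q0 : q != 0)
    (n : nat) (hn : (0 < n)%N) (j : int) (Q := q ^+ 3) :
  \sum_(0 <= r < n.+1)
     (cubic_weight q n r * qpoch_inv Q (r%:Z - j) * qpoch_inv Q (r%:Z + j))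
  = Q ^ (j ^+ 2) * qpoch q q (2 * n).-1 * qpoch_inv q (n%:Z - 3 * j)
      * qpoch_inv q (n%:Z + 3 * j).
Proof.
have sq : Q ^ (j ^+ 2) = Q ^+ (`|j| ^ 2)%N.
  by rewrite -[RHS]/(Q ^ (`|j| ^ 2)%N%:Z); congr (Q ^ _); lia.
rewrite sq; have [j0|j0] := lerP 0 j.
  have jE : j = `|j|%N%:Z by lia.
  by rewrite [in LHS]jE cubic_sum_nat // -jE.
have jE : j = - `|j|%N%:Z by lia.
have jN : `|j|%N%:Z = - j by lia.
have := cubic_sum_nat hq q0 hn `|j|%N; rewrite jN mulrN -/Q !opprK.
under eq_bigr => r _ do rewrite mulrAC.
by move=> ->; ring.
Qed.

(** * Reduction of the bilateral sum to a finite window *)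

Lemma qbinom_central (F : fieldType) (q : F) (n : nat) (k : int) :
  qbinom q (2 * n)%:Z (n%:Z - k)
  = qpoch q q (2 * n) * qpoch_inv q (n%:Z - k) * qpoch_inv q (n%:Z + k).
Proof.
rewrite /qbinom /qpoch_inv.
have -> : (2 * n)%:Z - (n%:Z - k) = n%:Z + k by lia.
case: (0 <= n%:Z + k); case: (0 <= n%:Z - k); rewrite ?(mulr0, mul0r) //=.
by rewrite invfM mulrA mulrAC.
Qed.

(** The support is [|3j| <= n]; the wider window [|j| <= n] is chosen so that [bailey_pair_sum]
    applies with [M = n] to every [r <= n]. *)
Lemma qbinom_bilateral_nat (F : fieldType) (q : F) (c : int -> F) (n : nat) :
  \sum_(j \in [set: int]) (c j * qbinom q (2 * n)%:Z (n%:Z - 3 * j))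
  = \sum_(0 <= i < (2 * n).+1)
      (c (i%:Z - n%:Z) * qbinom q (2 * n)%:Z (n%:Z - 3 * (i%:Z - n%:Z))).
Proof.
pose s : seq int := [seq i%:Z - n%:Z | i <- index_iota 0 (2 * n).+1].
rewrite -(big_map (fun i : nat => i%:Z - n%:Z) predT
  (fun j => c j * qbinom q (2 * n)%:Z (n%:Z - 3 * j))) -/s.
rewrite [RHS]fsbig_seq; last by rewrite map_inj_uniq ?iota_uniq // => a b; lia.
apply/esym/fsbig_widen => // j [_ /= js].
rewrite qbinom_central; have [jn|nj] := lerP j n%:Z; last first.
  by rewrite [qpoch_inv q (_ - _)]qpoch_inv_neg ?(mulr0, mul0r) //; lia.
have [nj|jn'] := lerP (- n%:Z) j; last first.
  by rewrite [qpoch_inv q (n%:Z + 3 * j)]qpoch_inv_neg ?(mulr0, mul0r) //; lia.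
case: js; apply/mapP; exists (absz ((j : int) + n%:Z)); last by lia.
by rewrite mem_index_iota; lia.
Qed.

(** * The case [q = 0] *)

Lemma qpoch_0base (F : fieldType) (L : nat) : qpoch (0 : F) 0 L = 1.
Proof. by rewrite /qpoch big1 // => k _; rewrite mul0r subr0. Qed.

(** All q-Pochhammer symbols are 1 and every positive power of [q] is 0, so only [j = 0] survives
    and both sides equal 1. *)
Lemma cubic_identity_base0 (F : fieldType) (n : nat) (hn : (0 < n)%N) (q := 0 : F) :
  \sum_(0 <= j < n.+1 | (3 * j <= n)%N)
     (qpoch (q ^+ 3) (q ^+ 3) (n - j - 1)%N * (1 - q ^+ (2 * n))
        * q ^+ (3 * j ^ 2)) /
     (qpoch q q (n - 3 * j)%N * qpoch (q ^+ 6) (q ^+ 6) j)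
  = \sum_(j \in [set: int])
      ((-1) ^ j * q ^ (6 * j ^+ 2) * qbinom q (2 * n)%:Z (n%:Z - 3 * j)).
Proof.
rewrite qbinom_bilateral_nat /q !expr0n /= muln_eq0 /=.
have -> : (n == 0)%N = false by lia.
rewrite big_mkcond (bigD1_seq 0%N) ?mem_index_iota ?iota_uniq //=.
rewrite big1 ?addr0; last first.
  move=> j j0; case: ifP => // _.
  by rewrite expr0n muln_eq0 expn_eq0 (negbTE j0) /= mulr0 mul0r.
rewrite [RHS](bigD1_seq n) ?mem_index_iota ?iota_uniq //=; last by lia.
rewrite big1 ?addr0; last first.
  move=> i i0; have ni : i%:Z - n%:Z != 0 by lia.
  rewrite exp0rz mulf_eq0 sqrf_eq0 (negbTE ni) /=.
  by rewrite mulr0 mul0r.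
rewrite subrr qbinom_central mulr0 addr0 oppr0 addr0 qpoch_inv_nat.
rewrite !qpoch_0base !expr0z.
by rewrite !(invr1, subr0, mulr1, expr0z, mulr0, mul1r).
Qed.

Unset Implicit Arguments.
Set Strict Implicit.

(** * Combination of the two summations *)

Theorem theorem1p8 (F : fieldType) (q : F)
    (hq : forall k : nat, (0 < k)%N -> q ^+ k != 1)
    (n : nat) (hn : (0 < n)%N) :
  \sum_(0 <= j < n.+1 | (3 * j <= n)%N)
     (qpoch (q ^+ 3) (q ^+ 3) (n - j - 1)%N * (1 - q ^+ (2 * n))
        * q ^+ (3 * j ^ 2)) /
     (qpoch q q (n - 3 * j)%N * qpoch (q ^+ 6) (q ^+ 6) j)
  = \sum_(j \in [set: int])
      ((-1) ^ j * q ^ (6 * j ^+ 2) * qbinom q (2 * n)%:Z (n%:Z - 3 * j)).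
Proof.
have [->|q0] := eqVneq q 0; first exact: cubic_identity_base0.
have hQ := expr_neq1 hq (isT : 0 < 3)%N.
have Q0 : q ^+ 3 != 0 by rewrite expf_neq0.
rewrite qbinom_bilateral_nat.
(* Summing this double sum over [r] first gives the right side, over [j] first the left side. *)
transitivity (\sum_(0 <= i < (2 * n).+1) \sum_(0 <= r < n.+1)
  (1 - q ^+ (2 * n)) * (cubic_weight q n r
     * bailey_term (q ^+ 3) r (i%:Z - n%:Z))); last first.
  apply: eq_bigr => i _; set j := i%:Z - n%:Z.
  transitivity ((1 - q ^+ (2 * n)) * ((-1) ^ j * (q ^+ 3) ^ (j ^+ 2))
    * \sum_(0 <= r < n.+1) (cubic_weight q n r
       * qpoch_inv (q ^+ 3) (r%:Z - j) * qpoch_inv (q ^+ 3) (r%:Z + j))).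
    rewrite big_distrr /=; apply: eq_bigr => r _; rewrite /bailey_term; ring.
  rewrite cubic_sum // qbinom_central.
  (* The factor [1 - q^(2n)] completes [(q;q)_{2n-1}] to [(q;q)_{2n}]. *)
  have -> : (2 * n = (2 * n).-1.+1)%N by lia.
  rewrite qpochS -exprS /=.
  (* One power comes from [bailey_term], the other from [cubic_sum]. *)
  have -> : q ^ (6 * j ^+ 2) = (q ^+ 3) ^ (j ^+ 2) * (q ^+ 3) ^ (j ^+ 2).
    rewrite -expfzDr // -[q ^+ 3]/(q ^ 3) exprz_exp; congr (q ^ _); lia.
  ring.
rewrite exchange_big /= big_mkcond; apply: eq_big_nat => r /andP[_ rn].
rewrite -!big_distrr /= bailey_pair_sum // -exprM /cubic_weight.
(* The condition [3 * j <= n] of the theorem is the vanishing of [1/(q;q)_{n-3r}] at negative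
   index. *)
case: ifPn => [rn3|rn3]; last first.
  by rewrite [qpoch_inv q _]qpoch_inv_neg ?(mulr0, mul0r) //; lia.
have -> : n%:Z - 3 * r%:Z = (n - 3 * r)%N%:Z by lia.
rewrite qpoch_inv_nat invfM (exprM _ 3 (r ^ 2)).
ring.
Qed.
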